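(* Consider a finite region of the triangle lattice, and let $n$ be its number of faces. Any locally-valid MV assignment of it can be reconfigured to the canonical configuration $C$ using $2n$ flips.
   Context: The triangle lattice is the tiling of the plane by congruent equilateral triangles, placed so that its lines are vertical, at $+30^\circ$, and at $-30^\circ$ to the horizontal. The crease pattern is a finite region of this lattice; its triangles are the faces and the lattice edges between them are the creases. A mountain-valley (MV) assignment labels each crease mountain or valley. It is locally valid if every vertex in the interior of the region (each such vertex has six incident creases) has either 4 mountain and 2 valley creases, or 4 valley and 2 mountain creases. Flipping a face interchanges mountain and valley on all creases bordering that face and leaves all other creases unchanged. Reconfiguring one locally-valid MV assignment to another means performing a sequence of single face flips in which every MV assignment along the way is locally valid. The canonical configuration $C$ is the MV assignment that has mountain creases on the $-30^\circ$ lines of the lattice and valley creases on the other lines.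
   Formalization: The region is assumed to have no holes (the claim fails with holes, e.g. for the 12 triangles touching a removed triangle, where each flip changes two of the 12 creases), and ''using 2n flips'' is read as at most 2n flips. *)

(* Defs.v *)
From HB Require Import structures.
From mathcomp Require Import all_boot all_order all_algebra finmap.
From mathcomp Require Import zify.
Set Implicit Arguments.
Unset Strict Implicit.
Unset Printing Implicit Defensive.
Import Order.TTheory GRing.Theory Num.Theory.
Local Open Scope fset_scope.
Local Open Scope ring_scope.

(* The lattice vertex (i, j) is the point i * a + j * b of the plane, where
   a = (sqrt 3 / 2, 1 / 2) and b = (0, 1).  Hence b is vertical, a points in
   direction +30 degrees and a - b points in direction -30 degrees. *)
Definition vertex : Type := (int * int)%type.

Inductive direction := Vertical | Plus30 | Minus30.

Definition direction_code (d : direction) : 'I_3 :=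
  match d with
  | Vertical => @Ordinal 3 0 isT
  | Plus30 => @Ordinal 3 1 isT
  | Minus30 => @Ordinal 3 2 isT
  end.

Definition direction_decode (i : 'I_3) : direction :=
  match val i with 0%N => Vertical | 1%N => Plus30 | _ => Minus30 end.

Lemma direction_codeK : cancel direction_code direction_decode.
Proof. by case. Qed.

HB.instance Definition _ := Finite.copy direction (can_type direction_codeK).

(* (p, d) is the unit edge joining p to p + step d. *)
Definition edge : Type := (vertex * direction)%type.

(* (p, false) is the triangle p, p + a, p + b, and
   (p, true) is the triangle p + a, p + b, p + a + b. *)
Definition face : Type := (vertex * bool)%type.

Definition step (d : direction) : vertex :=
  match d with
  | Vertical => (0, 1)
  | Plus30 => (1, 0)
  | Minus30 => (1, -1)
  end.

Definition ends (e : edge) : seq vertex := [:: e.1; e.1 + step e.2].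

Definition corners (f : face) : seq vertex :=
  let p := f.1 in
  if f.2 then [:: p + (1, 0); p + (0, 1); p + (1, 1)]
  else [:: p; p + (1, 0); p + (0, 1)].

Definition sides (f : face) : seq edge :=
  let p := f.1 in
  if f.2 then
    [:: (p + (1, 0), Vertical); (p + (0, 1), Plus30); (p + (0, 1), Minus30)]
  else [:: (p, Vertical); (p, Plus30); (p + (0, 1), Minus30)].

Lemma mem_sides (e : edge) (f : face) :
  (e \in sides f) = all [in corners f] (ends e).
Proof.
case: e => [[i j] d]; case: f => [[k l] b].
rewrite /sides /ends /corners /=.
case: b; case: d; rewrite /= !inE -!pair_eqE /= -!pair_eqE /=;
  rewrite -?pair_eqE /= ?andbT ?andbF /=; lia.
Qed.

(* The edges between two faces of R; the outer boundary of R is not creased. *)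
Definition creases (R : {fset face}) : {fset edge} :=
  [fset e in flatten [seq sides f | f <- R]
     | (1 < count (fun f => e \in sides f) R)%N].

Definition interior (R : {fset face}) (v : vertex) : Prop :=
  forall f : face, v \in corners f -> f \in R.

Definition touching : rel face := fun f g => has [in corners f] (corners g).

(* No holes: the closed triangles outside R have a connected union.
   Equivalently, every connected component of the topological interior of the
   union of the closed triangles of R is simply connected. *)
Definition hole_free (R : {fset face}) : Prop :=
  forall f g : face, f \notin R -> g \notin R ->
  exists p : seq face,
    [/\ path touching f p, all [predC R] p & last f p = g].

(* true stands for mountain, false for valley. *)
Definition assignment (R : {fset face}) : Type := {ffun creases R -> bool}.

Definition degree_at (R : {fset face}) (mu : assignment R) (b : bool)
    (v : vertex) : nat :=
  #|[set e : creases R | (v \in ends (val e)) && (mu e == b)]|.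

Definition locally_valid (R : {fset face}) (mu : assignment R) : Prop :=
  forall v : vertex, interior R v ->
    (degree_at mu true v = 4%N /\ degree_at mu false v = 2%N) \/
    (degree_at mu false v = 4%N /\ degree_at mu true v = 2%N).

Definition flip (R : {fset face}) (f : face) (mu : assignment R) :
    assignment R :=
  [ffun e => if val e \in sides f then ~~ mu e else mu e].

(* reconfigures k mu nu: k face flips lead from mu to nu through locally valid
   assignments, mu and nu included. *)
Inductive reconfigures (R : {fset face}) :
    nat -> assignment R -> assignment R -> Prop :=
| ReconfiguresNil (mu : assignment R) :
    locally_valid mu -> reconfigures 0 mu mu
| ReconfiguresFlip (k : nat) (f : face) (mu nu : assignment R) :
    f \in R -> locally_valid mu -> reconfigures k (flip f mu) nu ->
    reconfigures k.+1 mu nu.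

Definition canonical (R : {fset face}) : assignment R :=
  [ffun e => (val e).2 == Minus30].

(* Main.v *)
Require Import Defs.
From mathcomp Require Import all_boot all_order all_algebra finmap.
From mathcomp Require Import zify.
(* Changing the canonical assignment along the boundary of a set of faces, i.e.
   along a 2-colouring c of the faces, preserves the parity of the number of
   mountains at every interior vertex, and in a region without holes every
   locally valid assignment arises in this way: the difference with the
   canonical assignment is an even edge labelling, which extends from the
   creases to the plane once its odd vertices are pushed far away along edges
   that are not creases, and can then be integrated.

   Of the six faces around a vertex, three are of the form (p, false) and three
   of the form (p, true).  The assignment of c violates the condition at the
   vertex exactly if c is bad on both triples, where a triple is bad if a certain
   face of it (the one whose bisector at the vertex is perpendicular to the
   creases at -30 degrees) has a colour different from the common colour of the
   other two.  Hence one may first turn the faces (p, false) into alternating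
   rows, which has no bad triple, then erase the faces (p, true), and finally
   erase the faces (p, false).  Each face (p, false) is flipped at most twice and
   each face (p, true) at most once. *)

Set Implicit Arguments.
Unset Strict Implicit.
Unset Printing Implicit Defensive.
Import Order.TTheory GRing.Theory Num.Theory.
Local Open Scope fset_scope.
Local Open Scope ring_scope.

(** * Incidence of edges, faces and vertices *)

Definition side_face (e : edge) (b : bool) : face :=
  let: ((i, j), d) := e in
  (match d, b with
   | Minus30, _ | Plus30, true => (i, j - 1)
   | Vertical, true => (i - 1, j)
   | _, false => (i, j)
   end, b).

Lemma mem_sides_side_face e f : (e \in sides f) = (f == side_face e f.2).
Proof.
case: e => [[i j] d]; case: f => [[k l] b].
rewrite /sides /side_face /=.
by case: b; case: d; rewrite /= !inE -!pair_eqE /= -!pair_eqE /=;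
  rewrite -?pair_eqE /= ?andbT ?andbF /=; lia.
Qed.

Lemma side_face2 e b : (side_face e b).2 = b.
Proof. by case: e => [[i j] d]. Qed.

(** Every edge borders exactly one face of each kind, so a count above 1 means that both of these
    are in [R]. *)
Lemma mem_creases (R : {fset face}) e :
  (e \in creases R) = (side_face e false \in R) && (side_face e true \in R).
Proof.
have countE : count (fun f => e \in sides f) R
    = ((side_face e false \in R) + (side_face e true \in R))%N.
  rewrite -!(count_uniq_mem _ (fset_uniq R)) -count_predUI.
  rewrite [X in (_ + X)%N](@eq_count _ _ pred0) => [|f]; last first.
    by rewrite /=; apply/andP => -[/eqP-> /eqP/(congr1 snd)]; rewrite !side_face2.
  rewrite count_pred0 addn0; apply: eq_count => f /=.
  rewrite mem_sides_side_face; case: f => p [] /=.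
    by rewrite [X in _ = X || _](introF eqP) // => /(congr1 snd); rewrite side_face2.
  by rewrite orbC [X in _ = X || _](introF eqP) // => /(congr1 snd); rewrite side_face2.
rewrite /creases !inE /= countE.
case: (boolP (side_face e false \in R)) => [Rf|_]; last by case: (side_face e true \in R); apply: andbF.
case: (side_face e true \in R); rewrite ?andbF ?andbT //.
apply/flattenP; exists (sides (side_face e false)).
  by apply/mapP; exists (side_face e false).
by rewrite mem_sides_side_face side_face2.
Qed.

Definition star (v : vertex) : seq edge :=
  let: (i, j) := v in
  [:: ((i, j), Vertical); ((i, j), Plus30); ((i, j), Minus30);
      ((i, j - 1), Vertical); ((i - 1, j), Plus30); ((i - 1, j + 1), Minus30)].

Lemma mem_star v e : (e \in star v) = (v \in ends e).
Proof.
case: e => [[i j] d]; case: v => [k l].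
by case: d; rewrite /= !inE -!pair_eqE /= -?pair_eqE /= ?andbT ?andbF /=; lia.
Qed.

Lemma star_uniq v : uniq (star v).
Proof.
case: v => i j.
by rewrite /= !inE -!pair_eqE /= -?pair_eqE /= ?andbT ?andbF /=; lia.
Qed.

Lemma star_creases (R : {fset face}) v e :
  interior R v -> e \in star v -> e \in creases R.
Proof.
move=> Rv; rewrite mem_star mem_creases => ev.
have corner b : v \in corners (side_face e b).
  have := mem_sides e (side_face e b).
  by rewrite mem_sides_side_face side_face2 eqxx => /esym/allP; apply.
by rewrite !Rv.
Qed.

Definition crease_value (R : {fset face}) (mu : assignment R) (e : edge) : bool :=
  if insub e is Some e' then mu e' else false.

Lemma degree_at_count (R : {fset face}) (mu : assignment R) b v :
  interior R v ->
  degree_at mu b v = count (fun e => crease_value mu e == b) (star v).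
Proof.
move=> Rv; rewrite /degree_at cardsE cardE -(size_map val) -size_filter.
apply: perm_size; apply: uniq_perm.
- by rewrite (map_inj_uniq val_inj) enum_uniq.
- by rewrite filter_uniq ?star_uniq.
move=> e; rewrite mem_filter mem_star; apply/mapP/andP.
  case=> x; rewrite mem_enum => /andP[ve /eqP mx] ->.
  by rewrite /crease_value valK mx.
case=> mx ve; have eR : e \in creases R by apply: star_creases Rv _; rewrite mem_star.
exists [` eR] => //; rewrite mem_enum; apply/andP; split; first exact: ve.
by move: mx; rewrite /crease_value insubT.
Qed.

(** * Assignments that come from face colourings *)

Definition coloring_value (c : face -> bool) (e : edge) : bool :=
  (e.2 == Minus30) (+) c (side_face e false) (+) c (side_face e true).

Definition coloring_assignment (R : {fset face}) (c : face -> bool) :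
    assignment R :=
  [ffun e => coloring_value c (val e)].

Definition bad_false (c : face -> bool) (v : vertex) : bool :=
  let: (i, j) := v in
  (c ((i - 1, j), false) == c ((i, j - 1), false))
  && (c ((i, j), false) != c ((i, j - 1), false)).

Definition bad_true (c : face -> bool) (v : vertex) : bool :=
  let: (i, j) := v in
  (c ((i - 1, j), true) == c ((i, j - 1), true))
  && (c ((i - 1, j - 1), true) != c ((i, j - 1), true)).

Definition valid_coloring (R : {fset face}) (c : face -> bool) : Prop :=
  forall v, interior R v -> ~~ (bad_false c v && bad_true c v).

(** The six labels at a vertex depend only on the colours of the six faces around it, which leaves
    64 cases to check. *)
Lemma coloring_locally_validP (R : {fset face}) c :
  locally_valid (coloring_assignment R c) <-> valid_coloring R c.
Proof.
have countE v b : interior R v ->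
    degree_at (coloring_assignment R c) b v
    = count (fun e => coloring_value c e == b) (star v).
  move=> Rv; rewrite degree_at_count //.
  apply: eq_in_count => e /(star_creases Rv) eR.
  by rewrite /crease_value insubT ffunE.
suff localE v : interior R v ->
    ((degree_at (coloring_assignment R c) true v = 4%N
      /\ degree_at (coloring_assignment R c) false v = 2%N)
     \/ (degree_at (coloring_assignment R c) false v = 4%N
      /\ degree_at (coloring_assignment R c) true v = 2%N))
    <-> ~~ (bad_false c v && bad_true c v).
  by split=> H v Rv; apply/(localE v Rv); exact: H.
move=> Rv; rewrite !countE //; case: v {Rv} => i j.
rewrite /coloring_value /= addrK.
case: (c (i, j, false)); case: (c (i - 1, j, false)); case: (c (i, j - 1, false));
  case: (c (i - 1, j, true)); case: (c (i, j - 1, true)); case: (c (i - 1, j - 1, true));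
  by rewrite /=; split=> [[[]|[]]|]; auto.
Qed.

Definition toggle (f : face) (c : face -> bool) : face -> bool :=
  fun g => (g == f) (+) c g.

Lemma flip_coloring (R : {fset face}) f c :
  flip f (coloring_assignment R c) = coloring_assignment R (toggle f c).
Proof.
apply/ffunP => e; rewrite !ffunE mem_sides_side_face /coloring_value /toggle.
rewrite (eq_sym _ f) (eq_sym _ f).
have neq b : b != f.2 -> (f == side_face (val e) b) = false.
  by move=> bf; apply/eqP => ef; rewrite ef side_face2 eqxx in bf.
case f2 : f.2.
  by rewrite (neq false) ?f2 //=; case: ifP => _ //=; rewrite addbN.
by rewrite (neq true) ?f2 //=; case: ifP => _ //=; rewrite addbN addNb.
Qed.

Lemma eq_coloring (R : {fset face}) c c' :
  {in R, c =1 c'} -> coloring_assignment R c = coloring_assignment R c'.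
Proof.
move=> cc'; apply/ffunP => e; rewrite !ffunE /coloring_value.
by have := valP e; rewrite mem_creases => /andP[/cc' -> /cc' ->].
Qed.

(** * Flip sequences guided by a target colouring *)

Lemma reconfigures_trans (R : {fset face}) k l (mu nu xi : assignment R) :
  reconfigures k mu nu -> reconfigures l nu xi -> reconfigures (k + l) mu xi.
Proof.
by elim=> // {}k f {}mu {}nu Rf lv _ IH /IH; exact: ReconfiguresFlip.
Qed.

(** Greedy principle: if under an invariant [P] some face that disagrees with the target [t] can
    always be flipped, then each disagreeing face is flipped exactly once. *)
Lemma reconfigures_coloring (R : {fset face}) (P : (face -> bool) -> Prop)
    (t c : face -> bool) :
  (forall c, P c -> locally_valid (coloring_assignment R c)) ->
  (forall c, P c -> has (fun f => c f != t f) R ->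
     exists f, [/\ f \in R, c f != t f & P (toggle f c)]) ->
  P c ->
  reconfigures (count (fun f => c f != t f) R)
    (coloring_assignment R c) (coloring_assignment R t).
Proof.
move=> Pvalid Pstep.
move nE: (count (fun f => c f != t f) R) => n; elim: n c nE => [|n IH] c cn Pc.
  have <- : coloring_assignment R c = coloring_assignment R t.
    apply: eq_coloring => f Rf; apply/eqP/negPn/negP => cf.
    have: has (fun f => c f != t f) R by apply/hasP; exists f.
    by rewrite has_count cn.
  exact/ReconfiguresNil/Pvalid.
have [|f [Rf cf Pf]] := Pstep c Pc; first by rewrite has_count cn.
apply: (@ReconfiguresFlip _ _ f) => //; first exact: Pvalid.
rewrite flip_coloring; apply: IH Pf.
have /permP pR := perm_to_rem Rf; move: cn; rewrite !pR /= /toggle eqxx cf add1n.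
have -> : (~~ c f == t f) by move: cf; case: (c f); case: (t f).
case=> <-; apply: eq_in_count => g; rewrite mem_rem_uniq ?fset_uniq // inE.
by case/andP => /negbTE->.
Qed.

Definition faces_at (v : vertex) : seq face :=
  let: (i, j) := v in
  [:: ((i, j), false); ((i - 1, j), false); ((i, j - 1), false);
      ((i - 1, j), true); ((i, j - 1), true); ((i - 1, j - 1), true)].

Lemma mem_faces_at v f : (f \in faces_at v) = (v \in corners f).
Proof.
case: f => [[i j] b]; case: v => [k l].
by case: b; rewrite /corners /= !inE -!pair_eqE /= -?pair_eqE /= ?andbT ?andbF /=; lia.
Qed.

Lemma interiorP (R : {fset face}) v :
  reflect (interior R v) (all [in R] (faces_at v)).
Proof.
apply: (iffP allP) => Rv f; first by rewrite -mem_faces_at; apply: Rv.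
by rewrite mem_faces_at; apply: Rv.
Qed.

Lemma interior_false (R : {fset face}) i j :
  interior R (i, j) ->
  [/\ ((i, j), false) \in R, ((i - 1, j), false) \in R
    & ((i, j - 1), false) \in R].
Proof. by move/interiorP => /= /and4P[]. Qed.

Lemma seq_argmin (T : eqType) (s : seq T) (P : pred T) (m : T -> int) :
  has P s ->
  exists x, [/\ x \in s, P x & forall y, y \in s -> P y -> m x <= m y].
Proof.
elim: s => //= a s IH; case: (boolP (has P s)) => [/IH [x [sx Px xmin]] _|/hasPn nP].
  case: (boolP (P a && (m a <= m x))) => [/andP[Pa ax]|nPa].
    exists a; split=> //; first exact: mem_head.
    move=> y; rewrite inE => /predU1P[->//|sy] Py; exact: le_trans ax (xmin y sy Py).
  exists x; split=> //; first by rewrite inE sx orbT.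
  move=> y; rewrite inE => /predU1P[->|]; last exact: xmin.
  by move=> Pa; move: nPa; rewrite Pa -ltNge => /ltW.
rewrite orbF => Pa; exists a; split=> //; first exact: mem_head.
by move=> y; rewrite inE => /predU1P[->//|/nP/negP].
Qed.

(** * Stripes and the three phases of the reconfiguration *)

Definition stripe (f : face) : bool := odd `|f.1.1|.

(** The two faces that [bad_false] requires to agree have consecutive first coordinates; hence
    stripes have no bad triple. *)
Lemma stripe_pred i j k b b' : stripe ((i - 1, j), b) = ~~ stripe ((i, k), b').
Proof. rewrite /stripe /=; lia. Qed.

Lemma toggle_other f c g : g != f -> toggle f c g = c g.
Proof. by rewrite /toggle => /negbTE->. Qed.

Lemma toggle_same f c : toggle f c f = ~~ c f.
Proof. by rewrite /toggle eqxx. Qed.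

(* In the first row i + j = const with a face to change, take the last such face
   that is not blocked at the vertex it shares with its left neighbour.  If it
   were blocked at the vertex it shares with its right neighbour, then that
   neighbour would have to be changed too, and would not be blocked on its left. *)
Lemma stripes_step (R : {fset face}) (c : face -> bool) :
  valid_coloring R c ->
  has (fun f => ~~ f.2 && (c f != stripe f)) R ->
  exists f, [/\ f \in R, ~~ f.2, c f != stripe f & valid_coloring R (toggle f c)].
Proof.
move=> cval /(seq_argmin (fun f => f.1.1 + f.1.2)) [f0 [Rf0 f0d rowmin]].
pose diff f := [&& ~~ f.2, c f != stripe f & f.1.1 + f.1.2 == f0.1.1 + f0.1.2].
have /(seq_argmin (fun f => f.1.1)) [f1 [Rf1 f1d f1min]] : has diff R.
  by apply/hasP; exists f0; rewrite /diff ?eqxx ?andbT.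
pose left (f : face) : face := ((f.1.1 - 1, f.1.2 + 1), false).
(* The left neighbour shares the vertex [(i, j + 1)] with [f]; if it lies outside [R], that vertex
   is not interior and cannot block. *)
pose good f := diff f &&
  ~~ ((left f \in R) && bad_false (toggle f c) (f.1.1, f.1.2 + 1)).
(* The leftmost face [f1] to change is good: a left neighbour in [R] already has its stripe colour,
   and so does [f1] once toggled, so the two differ. *)
have /(seq_argmin (fun f => - f.1.1)) [f [Rf fgood fmax]] : has good R.
  apply/hasP; exists f1 => //; rewrite /good f1d /=; apply/negP => /andP[Rl].
  case: f1 Rf1 f1d f1min Rl => -[i j] [] //= Rf1 /and3P[_ c1 /eqP row] f1min Rl.
  case/andP => + _; rewrite addrK toggle_same toggle_other; last first.
    by rewrite -!pair_eqE /= -!pair_eqE /=; clear; lia.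
  case: (boolP (c (i - 1, j + 1, false) == stripe (i - 1, j + 1, false))) => [/eqP->|cl].
    rewrite (stripe_pred _ _ j _ false).
    by move: c1; case: (c _); case: (stripe _).
  by have := f1min _ Rl; rewrite /diff /= cl -row /=; clear; lia.
exists f; case/andP: (fgood) => /and3P[f2 cf /eqP row] fok; split=> // v Rv.
case: f Rf fgood fmax f2 cf row fok => -[i j] [] // Rf fgood fmax _ cf /= row fok.
case: v Rv => k l Rv; have [R1 R2 R3] := interior_false Rv.
have := cval _ Rv.
have bt : bad_true (toggle (i, j, false) c) (k, l) = bad_true c (k, l).
  by rewrite /bad_true !toggle_other // -!pair_eqE /= ?andbF.
rewrite bt; case: (bad_true c (k, l)); rewrite ?andbF // !andbT => cbad.
(* At this corner of [f] the other two faces lie in the preceding row, which already agrees with the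
   stripes. *)
have [ijkl|n1] := eqVneq (i, j) (k, l).
  case: ijkl R1 R2 R3 => <- <- R1 R2 R3.
  rewrite /bad_false.
  have low f' : f' \in R -> ~~ f'.2 -> f'.1.1 + f'.1.2 < i + j -> c f' = stripe f'.
    move=> Rf' f'2 lt; apply/eqP/negPn/negP => cf'.
    have := rowmin _ Rf'; by rewrite f'2 cf' -row leNgt lt => /(_ isT).
  rewrite (@toggle_other _ _ (i - 1, j, false)) ?(@toggle_other _ _ (i, j - 1, false));
    try by rewrite -!pair_eqE /= -!pair_eqE /=; clear; lia.
  rewrite (low (i - 1, j, false)) ?(low (i, j - 1, false)) //=; try by clear; lia.
  rewrite (stripe_pred _ _ (j-1) _ false).
  by case: (stripe (i, j - 1, false)).
have [ijkl|n2] := eqVneq (i, j + 1) (k, l).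
  have [ik jl] : i = k /\ j + 1 = l
    by split; [apply: (congr1 fst ijkl) | apply: (congr1 snd ijkl)].
  by subst k l; move: fok; rewrite /left /= R2.
have [ijkl|n3] := eqVneq (i + 1, j) (k, l); last first.
  by rewrite /bad_false !toggle_other //; move: n1 n2 n3;
    rewrite -!pair_eqE /= -!pair_eqE /=; clear; lia.
have [ik jl] : i + 1 = k /\ j = l
    by split; [apply: (congr1 fst ijkl) | apply: (congr1 snd ijkl)].
subst k l.
(* At the right corner, blocking forces the right neighbour to have the wrong colour and to be good,
   against the choice of [f] as the last good face. *)
apply/negP => bad; move: (bad); rewrite /bad_false addrK toggle_same.
rewrite !toggle_other; try by rewrite -!pair_eqE /= -!pair_eqE /=; clear; lia.
case/andP => /eqP cq cv.
have sp := stripe_pred (i + 1) j (j - 1) false false; rewrite addrK in sp.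
have cq' : c (i + 1, j - 1, false) != stripe (i + 1, j - 1, false).
  by move: cf sp; rewrite -cq; case: (c _); case: (stripe (i, j, false)); case: (stripe _).
have := fmax _ R3; rewrite /good /diff /= cq'.
rewrite /left /= addrK subrK Rf /=.
have -> : i + 1 + (j - 1) = f0.1.1 + f0.1.2 by rewrite -row; clear; lia.
rewrite eqxx /= => H.
suff : - i <= - (i + 1) by clear; lia.
apply: H; apply/negP => /andP[/eqP].
rewrite toggle_same toggle_other; last by rewrite -!pair_eqE /= -!pair_eqE /=; clear; lia.
move=> _; rewrite toggle_other; last by rewrite -!pair_eqE /= -!pair_eqE /=; clear; lia.
by move: cv; case: (c (i + 1, j, false)); case: (c _).
Qed.

(** Only the first phase, up to [c1], needs a careful order of flips. Afterwards one kind of face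
    has no bad triple throughout, so the faces of the other kind may be flipped in any order. *)
Lemma reconfigures_canonical (R : {fset face}) (c : face -> bool) :
  valid_coloring R c ->
  exists2 k : nat, (k <= 2 * #|` R|)%N
    & reconfigures k (coloring_assignment R c) (canonical R).
Proof.
move=> cval.
pose c1 (f : face) := if f.2 then c f else stripe f.
pose c2 (f : face) := if f.2 then false else stripe f.
have bad_stripe (c' : face -> bool) v : interior R v ->
    (forall f : face, f \in R -> ~~ f.2 -> c' f = stripe f) ->
  ~~ bad_false c' v.
  case: v => i j /interior_false[R1 R2 R3] cs.
  rewrite /bad_false !cs //= (stripe_pred _ _ (j-1) _ false).
  by case: (stripe (i, j - 1, false)).
have p1 : reconfigures (count (fun f : face => c f != c1 f) R)
  (coloring_assignment R c) (coloring_assignment R c1).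
  apply: (@reconfigures_coloring R
    (fun c' => valid_coloring R c' /\ (forall f : face, f.2 -> c' f = c f)) c1 c).
  - by move=> c' [/coloring_locally_validP].
  - move=> c' [c'val c'c] /hasP[f Rf].
    rewrite /c1; case f2: f.2; first by rewrite c'c ?f2 ?eqxx.
    move=> c'f; have [|g [Rg g2 c'g gval]] := @stripes_step R c' c'val.
      by apply/hasP; exists f; rewrite ?f2.
    exists g; rewrite (negbTE g2); split=> //; split=> // h h2.
    by rewrite toggle_other ?c'c //; apply: contraNneq g2 => <-.
  - by [].
have p2 : reconfigures (count (fun f : face => c1 f != c2 f) R)
  (coloring_assignment R c1) (coloring_assignment R c2).
  apply: (@reconfigures_coloring R
    (fun c' => forall f : face, ~~ f.2 -> c' f = stripe f) c2 c1).
  - move=> c' cs; apply/coloring_locally_validP => v Rv.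
    by rewrite negb_and bad_stripe // => f _; exact: cs.
  - move=> c' cs /hasP[f Rf].
    rewrite /c2; case f2: f.2; last by rewrite cs ?f2 ?eqxx.
    move=> c'f; exists f; rewrite f2; split=> // h h2.
    by rewrite toggle_other ?cs //; apply: contraNneq h2 => ->; rewrite f2.
  - by move=> f /negbTE; rewrite /c1 => ->.
have p3 : reconfigures (count (fun f : face => c2 f != false) R)
  (coloring_assignment R c2) (coloring_assignment R xpred0).
  apply: (@reconfigures_coloring R
    (fun c' => forall f : face, f.2 -> c' f = false) xpred0 c2).
  - move=> c' c0; apply/coloring_locally_validP => -[i j] _.
    by rewrite /bad_true !c0 ?andbF.
  - move=> c' c0 /hasP[f Rf] cf; exists f; split=> // h h2.
    rewrite toggle_other ?c0 //; apply: contraNneq cf => <-; by rewrite c0.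
  - by move=> f; rewrite /c2 => ->.
have <- : coloring_assignment R xpred0 = canonical R.
  by apply/ffunP => e; rewrite !ffunE /coloring_value !addbF.
eexists; last exact: reconfigures_trans p1 (reconfigures_trans p2 p3).
have sizeE : #|` R|
    = (count (fun f : face => f.2) R + count (fun f : face => ~~ f.2) R)%N.
  by rewrite -(count_predC (fun f => f.2) R).
have le1 : (count (fun f : face => c f != c1 f) R <= count (fun f : face => ~~ f.2) R)%N.
  by apply: sub_count => f; rewrite /c1; case: f.2; rewrite ?eqxx.
have le2 : (count (fun f : face => c1 f != c2 f) R <= count (fun f : face => f.2) R)%N.
  by apply: sub_count => f; rewrite /c1 /c2; case: f.2; rewrite ?eqxx.
have le3 : (count (fun f : face => c2 f != false) R <= count (fun f : face => ~~ f.2) R)%N.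
  by apply: sub_count => f; rewrite /c2; case: f.2.
rewrite sizeE; lia.
Qed.

(** * Parities of edge labellings and removal of odd vertices *)

Definition parity (x : edge -> bool) (v : vertex) : bool :=
  odd (count x (star v)).

Lemma parity_addb x y v :
  parity (fun e => x e (+) y e) v = parity x v (+) parity y v.
Proof.
rewrite /parity; elim: (star v) => //= e s IH.
by rewrite !oddD IH !oddb addbACA.
Qed.

Lemma parity_pred1 e v : parity (pred1 e) v = (v \in ends e).
Proof. by rewrite /parity (count_uniq_mem _ (star_uniq v)) mem_star oddb. Qed.

(* v and w are joined if they are the odd vertices of a set of edges, such as the
   edges of a path, that are not creases. *)
Definition joined (R : {fset face}) (v w : vertex) : Prop :=
  exists2 y : edge -> bool, (forall e, e \in creases R -> y e = false)
    & forall u, parity y u = (u == v) (+) (u == w).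

Lemma joined_refl R v : joined R v v.
Proof.
exists xpred0 => // u; rewrite addbb /parity (@eq_count _ _ pred0) //.
by rewrite count_pred0.
Qed.

Lemma joined_sym R v w : joined R v w -> joined R w v.
Proof. by case=> y yR yp; exists y => // u; rewrite yp addbC. Qed.

Lemma joined_trans R v w z : joined R v w -> joined R w z -> joined R v z.
Proof.
case=> x xR xp [y yR yp]; exists (fun e => x e (+) y e) => [e eR|u].
  by rewrite xR ?yR.
by rewrite parity_addb xp yp addbA addbK.
Qed.

Lemma joined_ends (R : {fset face}) e :
  e \notin creases R -> joined R e.1 (e.1 + step e.2).
Proof.
move=> eR; exists (pred1 e) => [e' e'R|u].
  by apply/negbTE; apply: contraNneq eR => <-.
rewrite parity_pred1 /ends !inE.
case: eqVneq => [->|] //=; case: eqP => // /eqP.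
by case: e {eR} => [[i j] []]; rewrite -!pair_eqE /=; clear; lia.
Qed.

(** No side of a face outside [R] is a crease, and two of its sides already connect its three
    corners. *)
Lemma joined_corners (R : {fset face}) f v w :
  f \notin R -> v \in corners f -> w \in corners f -> joined R v w.
Proof.
move=> fR.
have free e : e \in sides f -> joined R e.1 (e.1 + step e.2).
  rewrite mem_sides_side_face => /eqP fe; apply: joined_ends.
  by rewrite mem_creases; move: fR; rewrite fe; case: (f.2) => /negbTE->; rewrite ?andbF.
suff [h hub] : exists h, forall u, u \in corners f -> joined R h u.
  by move=> /hub/joined_sym vh /hub; apply: joined_trans.
case: f {fR} free => -[i j] []; rewrite /sides /corners /= => free.
  exists ((i, j) + (1, 1)) => u; rewrite !inE => /or3P[] /eqP->.
  - have := free ((i, j) + (1, 0), Vertical); rewrite inE eqxx => /(_ isT) /= /joined_sym.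
    by rewrite -addrA.
  - have := free ((i, j) + (0, 1), Plus30); rewrite !inE eqxx orbT => /(_ isT) /= /joined_sym.
    by rewrite -addrA.
  - exact: joined_refl.
exists (i, j) => u; rewrite !inE => /or3P[] /eqP->; first exact: joined_refl.
- by have := free ((i, j), Plus30); rewrite !inE eqxx orbT => /(_ isT).
- by have := free ((i, j), Vertical); rewrite inE eqxx => /(_ isT).
Qed.

Lemma joined_path (R : {fset face}) f p v w :
  path touching f p -> all [predC R] (f :: p) ->
  v \in corners f -> w \in corners (last f p) -> joined R v w.
Proof.
elim: p f v => [|g p IH] f v /=.
  by move=> _ /andP[fR _]; exact: joined_corners.
case/andP=> /hasP[u ug uf] gp /andP[fR pR] vf wl.
exact: joined_trans (joined_corners fR vf uf) (IH _ _ gp pR ug wl).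
Qed.

(** Adding modulo 2 the edge set that joins an odd vertex to [w0] makes this vertex even, changes no
    crease, and affects no other parity except that of [w0]. *)
Lemma even_extension (R : {fset face}) w0 (s : seq vertex) (x : edge -> bool) :
  {in s, forall v, joined R v w0} ->
  (forall v, parity x v -> v \in s \/ v = w0) ->
  exists2 x', {in creases R, x' =1 x} & forall v, v != w0 -> parity x' v = false.
Proof.
elim: s x => [|v s IH] x sw xs.
  exists x => // v; apply: contra_neqF => /xs[] //.
have sw' : {in s, forall v, joined R v w0}.
  by move=> u us; apply: sw; rewrite inE us orbT.
have [y yR yp] := sw v (mem_head v s).
case xv : (parity x v); last first.
  apply: IH => // u xu; have [|] := xs u xu; last by right.
  rewrite inE => /predU1P[uv|]; last by left.
  by rewrite uv xv in xu.
have [|x' x'R x'p] := IH (fun e => x e (+) y e) sw'.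
  move=> u; rewrite parity_addb yp.
  case: (eqVneq u w0) => [->|uw]; first by right.
  case: (eqVneq u v) => [->|uv]; first by rewrite xv.
  rewrite !addbF => /xs [|]; last by right.
  by rewrite inE (negbTE uv); left.
by exists x' => // e eR; rewrite x'R //= yR // addbF.
Qed.

(** * Integration of even labellings over a quadrant *)

(** A discrete Poincaré lemma: evenness at the vertices says that [x] sums to zero around each of
    them, so summing [x] over the edges crossed by a path of faces does not depend on the path. *)
Lemma even_potential (x : edge -> bool) (N : nat) :
  (forall i j : int, - N%:Z < i -> - N%:Z < j -> parity x (i, j) = false) ->
  exists c : face -> bool, forall e,
    (forall b, - N%:Z <= (side_face e b).1.1 /\ - N%:Z <= (side_face e b).1.2) ->
    x e = c (side_face e false) (+) c (side_face e true).
Proof.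
move=> xp.
(* [right] and [up] are the colour changes from [(i, j, false)] to the next face of this kind in
   either coordinate, passing through [(i, j, true)]. *)
pose right (i j : int) := x ((i, j + 1), Minus30) (+) x ((i + 1, j), Vertical).
pose up (i j : int) := x ((i, j + 1), Minus30) (+) x ((i, j + 1), Plus30).
have square (i j : int) : - N%:Z <= i -> - N%:Z <= j ->
  right i j (+) up (i + 1) j = up i j (+) right i (j + 1).
  move=> iN jN; have := xp (i + 1) (j + 1); rewrite /parity /= !addrK.
  rewrite !ltzD1 iN jN => /(_ isT isT); rewrite /right /up addn0 !oddD !oddb.
  case: (x _); case: (x _); case: (x _); case: (x _); case: (x _);
    by case: (x _); case: (x _).
(* The path runs along the bottom row of the quadrant first, then upwards; [Aright] follows from
   [square] by induction on the height. *)
pose A (m n : nat) :=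
  (\big[addb/false]_(k < m) right (k%:Z - N%:Z) (- N%:Z))
  (+) (\big[addb/false]_(k < n) up (m%:Z - N%:Z) (k%:Z - N%:Z)).
have Aup m n : A m n.+1 = A m n (+) up (m%:Z - N%:Z) (n%:Z - N%:Z).
  by rewrite /A big_ord_recr /= addbA.
have Aright m n : A m.+1 n = A m n (+) right (m%:Z - N%:Z) (n%:Z - N%:Z).
  elim: n => [|n IH].
    by rewrite /A !big_ord0 !addbF big_ord_recr /= add0r.
  rewrite !Aup IH; have := square (m%:Z - N%:Z) (n%:Z - N%:Z).
  rewrite !lerDr => /(_ isT isT).
  have -> : m%:Z - N%:Z + 1 = m.+1%:Z - N%:Z by clear; lia.
  have -> : n%:Z - N%:Z + 1 = n.+1%:Z - N%:Z by clear; lia.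
  by rewrite -!addbA => ->.
pose base (i j : int) := A `|(i + N%:Z)%R|%N `|(j + N%:Z)%R|%N.
have baseup (i j : int) : - N%:Z <= i -> - N%:Z <= j ->
    base i (j + 1) = base i j (+) up i j.
  move=> iN jN; rewrite /base.
  have -> : `|(j + 1 + N%:Z)%R|%N = `|(j + N%:Z)%R|%N.+1 by move: jN; clear; lia.
  by rewrite Aup; congr (_ (+) up _ _); move: iN jN; clear; lia.
have baseright (i j : int) : - N%:Z <= i -> - N%:Z <= j ->
    base (i + 1) j = base i j (+) right i j.
  move=> iN jN; rewrite /base.
  have -> : `|(i + 1 + N%:Z)%R|%N = `|(i + N%:Z)%R|%N.+1 by move: iN; clear; lia.
  by rewrite Aright; congr (_ (+) right _ _); move: iN jN; clear; lia.
exists (fun f => base f.1.1 f.1.2 (+) (f.2 && x ((f.1.1, f.1.2 + 1), Minus30))).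
case=> -[i j] [] /= H; have [] := H true; have [] := H false => /= i1 j1 i2 j2.
- have := baseright (i - 1) j i2 j2; rewrite /right subrK => ->.
  by rewrite addbF; case: (base _ _); case: (x (i - 1, _, _)); case: (x _).
- have := baseup i (j - 1) i2 j2; rewrite /up subrK => ->.
  by rewrite addbF; case: (base _ _); case: (x (i, j, Minus30)); case: (x _).
by rewrite subrK addbF addKb.
Qed.

Lemma faces_bounded (s : seq face) :
  exists N : nat, {in s, forall f, - N%:Z <= f.1.1 /\ - N%:Z <= f.1.2}.
Proof.
elim: s => [|f s [N sN]]; first by exists 0%N.
exists (N + `|f.1.1| + `|f.1.2|)%N => g; rewrite inE => /predU1P[->|/sN].
  by case: f => -[i j] b; rewrite /=; clear; lia.
by case: f g => -[i j] b [[k l] b']; rewrite /=; clear; lia.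
Qed.

Lemma coloring_of_locally_valid (R : {fset face}) (mu : assignment R) :
  hole_free R -> locally_valid mu -> exists c, mu = coloring_assignment R c.
Proof.
move=> hR hmu.
have [N RN] := faces_bounded R.
(* [w0] lies just outside the quadrant that contains [R], so odd parity there does not disturb the
   integration. *)
pose w0 : vertex := (- N%:Z - 1, 0).
pose f0 : face := (w0, false).
have f0R : f0 \notin R by apply/negP => /RN [] /=; clear; lia.
pose x e := (e \in creases R) && (crease_value mu e (+) (e.2 == Minus30)).
pose s := [seq v <- flatten [seq ends e | e <- creases R]
             | ~~ all [in R] (faces_at v)].
have [||x' x'R x'p] := @even_extension R w0 s x.
(* A vertex that is not interior has a face outside [R], which [hole_free] links to [f0] by touching
   faces outside [R]. *)
- move=> v; rewrite mem_filter => /andP[/allPn[f fv fR] _].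
  have [p [fp pR pl]] := hR _ _ fR f0R.
  apply: (joined_path fp); rewrite ?pl /= ?fR ?pR //.
    by rewrite -mem_faces_at.
  by rewrite /corners /= !inE eqxx.
- move=> v; case: (boolP (all [in R] (faces_at v))) => [/interiorP Rv|nRv] xv.
    move: xv.
    have -> : parity x v = odd (degree_at mu true v).
      have xE : {in star v, x =1 fun e => crease_value mu e (+) (e.2 == Minus30)}.
        by move=> e /(star_creases Rv) eR; rewrite /x eR.
      rewrite degree_at_count // /parity (eq_in_count xE).
      have := parity_addb (crease_value mu) (fun e => e.2 == Minus30) v.
      (* Each star has two edges at -30 degrees, so subtracting the canonical assignment keeps the
         parity. *)
      have -> : parity (fun e => e.2 == Minus30) v = false by case: (v).
      rewrite addbF {1}/parity => ->; congr (odd _).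
      by apply: eq_count => e; rewrite eqb_id.
    by case: (hmu v Rv) => -[d1 d2]; rewrite ?d1 ?d2.
  left; rewrite mem_filter nRv /=.
  have /hasP[e es /andP[eR _]] : has x (star v).
    by rewrite has_count; move: xv; rewrite /parity; case: count.
  apply/flattenP; exists (ends e); last by rewrite -mem_star.
  by apply/mapP; exists e.
have [|c xc] := @even_potential x' N.
  move=> i j iN jN; apply: x'p; rewrite -pair_eqE /=; move: iN; clear; lia.
exists c.
apply/ffunP => e; rewrite ffunE /coloring_value -addbA -xc => [|b]; last first.
  by apply: RN; have := valP e; rewrite mem_creases => /andP[]; case: b.
by rewrite x'R ?(valP e) // /x (valP e) /crease_value valK addbC addbK.
Qed.

Theorem theorem5p3 (R : {fset face}) (hR : hole_free R)
    (mu : assignment R) (hmu : locally_valid mu) :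
  exists2 k : nat, (k <= 2 * #|` R|)%N & reconfigures k mu (canonical R).
Proof.
have [c mu_c] := coloring_of_locally_valid hR hmu; move: hmu; rewrite mu_c.
by move/coloring_locally_validP/reconfigures_canonical.
Qed.
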